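(* Let $A:U_\infty\to\mathcal M^{n\times n}_{\rm sym}$ and $b:U_\infty\to\mathbb R^n$ be given functions. Assume there are constants $c_0>0$ and $M_1>0$ such that $\xi^{\rm T}A(x,t)\xi\ge c_0|\xi|^2$ and ${\rm Tr}(A(x,t))\le M_1$ for all $(x,t)\in U_\infty$ and $\xi\in\mathbb R^n$. Let $(T_k)_{k=0}^\infty$ be a strictly increasing sequence of nonnegative numbers and let $\tau_k=T_k-T_{k-1}$ for $k\ge1$. For each $k\ge1$, suppose $m_k$ is a number with $$|b(x,t)|\le m_k\quad\text{on }U\times(T_{k-1},T_k],$$ let $x_k$ be any point in $\mathbb R^n\setminus\bar U$, and set $$r_k=r_*(x_k),\quad R_k=R_*(x_k),\quad \beta_k=\frac{M_1+m_kR_k}{2c_0},\quad \eta_k=1-(r_k/R_k)^{2\beta_k}.$$ Assume $4c_0\beta_k\tau_k=R_k^2$ for all $k\ge1$. Let $w\in C(\bar U\times[T_0,\infty))\cap C^{2,1}_{x,t}(U\times(T_0,\infty))$ and define $J_k=\max_{x\in\bar U}w^+(x,T_k)$ for $k\ge0$. Suppose there is a function $F\in C([T_0,\infty),[0,\infty))$ such that $\widetilde Lw(x,t)\le F(t)$ for all $(x,t)\in U\times(T_0,\infty)$. Define $$\Lambda_0=J_0,\qquad \Lambda_k=\max_{(x,t)\in\Gamma\times[T_{k-1},T_k]}w^+(x,t)+\int_{T_{k-1}}^{T_k}F(t)\,{\rm d}t\quad\text{for }k\ge1.$$ Then, for all $k\ge1$, $$\max_{(x,t)\in\bar U\times[T_{k-1},T_k]}w^+(x,t)\le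 J_{k-1}+\Lambda_k$$ and $$J_k\le\sum_{m=0}^k\left[\left(\prod_{j=m+1}^k\eta_j\right)\Lambda_m\right].$$
   Context: $n\ge1$ is fixed; $U$ is a non-empty, open, bounded subset of $\mathbb R^n$ with boundary $\Gamma$ and closure $\bar U$. $U_\infty=U\times(0,\infty)$. $\mathcal M^{n\times n}_{\rm sym}$ is the set of real symmetric $n\times n$ matrices. $C^{2,1}_{x,t}(U\times I)$, for an interval $I$, is the class of continuous functions on $U\times I$ with continuous partial derivatives $\partial u/\partial t$, $\partial u/\partial x_i$, $\partial^2u/\partial x_i\partial x_j$. $\langle A,B\rangle={\rm Tr}(A^{\rm T}B)$; $D^2w$, $\nabla w$ are the Hessian and gradient in $x$. $w^+=\max\{0,w\}$. For $y\notin\bar U$: $r_*(y)=\min\{|x-y|:x\in\bar U\}$, $R_*(y)=\max\{|x-y|:x\in\bar U\}$. $\widetilde Lw=w_t-\langle A(x,t),D^2w\rangle+b(x,t)\cdot\nabla w$. An empty product equals $1$. *)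

(* Defs.v *)
From HB Require Import structures.
From mathcomp Require Import all_boot all_order all_algebra.
From mathcomp Require Import all_classical all_reals all_analysis.
Set Implicit Arguments.
Unset Strict Implicit.
Unset Printing Implicit Defensive.
Import Order.TTheory GRing.Theory Num.Theory.
Import numFieldNormedType.Exports.

Local Open Scope classical_set_scope.
Local Open Scope ring_scope.

Section Defs.
Context {R : realType}.

(* Points of R^n are row vectors. The library norm `|x| on 'rV[R]_n is the sup
   norm, so the Euclidean inner product and norm are defined here; the two norms
   give the same topology and the same bounded sets. *)
Definition dot {n : nat} (u v : 'rV[R]_n) : R := (u *m v^T) 0 0.
Definition enorm {n : nat} (u : 'rV[R]_n) : R := Num.sqrt (dot u u).

(* The largest (smallest) element of S, with junk value 0 if there is none. *)
Definition setmax (S : set R) : R := xget 0 (S `&` ubound S).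
Definition setmin (S : set R) : R := xget 0 (S `&` lbound S).

Definition rstar {n : nat} (U : set 'rV[R]_n) (y : 'rV[R]_n) : R :=
  setmin [set enorm (x - y) | x in closure U].
Definition Rstar {n : nat} (U : set 'rV[R]_n) (y : 'rV[R]_n) : R :=
  setmax [set enorm (x - y) | x in closure U].

Definition boundary {n : nat} (U : set 'rV[R]_n) : set 'rV[R]_n :=
  closure U `\` interior U.

Definition pospart {n : nat} (w : 'rV[R]_n -> R -> R) (x : 'rV[R]_n) (t : R) : R :=
  Num.max 0 (w x t).

Definition basis_vec {n : nat} (i : 'I_n) : 'rV[R]_n := delta_mx 0 i.

Definition dt {n : nat} (w : 'rV[R]_n -> R -> R) (x : 'rV[R]_n) (t : R) : R :=
  derive1 (w x) t.
Definition dx {n : nat} (i : 'I_n) (w : 'rV[R]_n -> R -> R)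
    (x : 'rV[R]_n) (t : R) : R :=
  'D_(basis_vec i) (fun y => w y t) x.

Definition gradx {n : nat} (w : 'rV[R]_n -> R -> R) (x : 'rV[R]_n) (t : R) :
    'rV[R]_n :=
  \row_i dx i w x t.
Definition hessx {n : nat} (w : 'rV[R]_n -> R -> R) (x : 'rV[R]_n) (t : R) :
    'M[R]_n :=
  \matrix_(i, j) dx i (dx j w) x t.

Definition cont_on {n : nat} (D : set ('rV[R]_n * R)) (w : 'rV[R]_n -> R -> R) :
    Prop :=
  {within D, continuous (fun p : 'rV[R]_n * R => w p.1 p.2)}.

(* The class C^{2,1}_{x,t}(U x I), for U and I open: the derivatives are
   two-sided, and the values of w outside U x I play no role. *)
Definition C21 {n : nat} (U : set 'rV[R]_n) (I : set R)
    (w : 'rV[R]_n -> R -> R) : Prop :=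
  [/\ cont_on (U `*` I) w,
      (forall x t, U x -> I t -> derivable (w x) t 1) /\
        cont_on (U `*` I) (dt w),
      (forall i : 'I_n,
        (forall x t, U x -> I t ->
           derivable (fun y => w y t) x (basis_vec i)) /\
        cont_on (U `*` I) (dx i w)) &
      (forall i j : 'I_n,
        (forall x t, U x -> I t ->
           derivable (fun y => dx j w y t) x (basis_vec i)) /\
        cont_on (U `*` I) (dx i (dx j w)))].

Definition frob {n : nat} (A B : 'M[R]_n) : R := \tr (A^T *m B).

Definition Ltilde {n : nat} (A : 'rV[R]_n -> R -> 'M[R]_n)
    (b : 'rV[R]_n -> R -> 'rV[R]_n) (w : 'rV[R]_n -> R -> R)
    (x : 'rV[R]_n) (t : R) : R :=
  dt w x t - frob (A x t) (hessx w x t) + dot (b x t) (gradx w x t).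

End Defs.

(* Main.v *)
Require Import Defs.
From HB Require Import structures.
From mathcomp Require Import all_boot all_order all_algebra.
From mathcomp Require Import all_classical all_reals all_analysis.
From mathcomp Require Import ring lra.
Set Implicit Arguments.
Unset Strict Implicit.
Unset Printing Implicit Defensive.
Import Order.TTheory GRing.Theory Num.Theory.
Import numFieldNormedType.Exports.
Local Open Scope classical_set_scope.
Local Open Scope ring_scope.

(** On one cylinder U x [a, e] with e - a = tau_k and s = t - a, the function
      V(x, s) = exp (al - beta ln s - |x - y|^2 / (4 c0 s))
    is a subsolution, because beta = (M1 + m R) / (2 c0) absorbs the trace and
    drift terms. With al = beta (1 + ln (r^2 / (4 c0 beta))) it satisfies V <= 1
    for |x - y| >= r, it tends to 0 as s -> 0, and V(., tau_k) >= (r/R)^(2 beta)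
    because 4 c0 beta tau_k = R^2. The weak maximum principle applied to
    w - int F + J_{k-1} V, and to w - int F, gives J_k <= eta_k J_{k-1} + Lambda_k
    and the first inequality; the second follows by induction. To avoid
    the behaviour of V at s = 0, s is replaced by s + de and de -> 0 at the end. *)

(** * Positive definite matrices *)

(** A block Cholesky factorization. The corner entry [a] is positive, and the Schur complement
    [D - a^-1 *: (u^T *m u)] of the remaining block is again symmetric and positive definite, so
    induction on the size applies to it. *)
Lemma sym_posdef_factor (R : rcfType) (n : nat) (A : 'M[R]_n) :
  A^T = A -> (forall xi : 'rV[R]_n, xi != 0 -> 0 < (xi *m A *m xi^T) 0 0) ->
  exists L : 'M[R]_n, A = L^T *m L.
Proof.
elim: n A => [|n IH] A symA posA.
  by exists 0; apply/matrixP => -[].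
pose A' : 'M[R]_(1 + n) := A.
pose a := A' 0 0; pose u := ursubmx A'; pose D := drsubmx A'.
have eA : A' = block_mx a%:M u u^T D.
  rewrite -[LHS]submxK; congr block_mx.
    apply/matrixP => i j; rewrite !mxE !ord1 eqxx mulr1n /a.
    by congr (A' _ _); apply: val_inj.
  by rewrite /u trmx_ursub symA.
have symD : D^T = D by rewrite /D trmx_drsub symA.
have qf (s : R) (z : 'rV[R]_n) :
    (row_mx s%:M z *m A' *m (row_mx s%:M z)^T) 0 0
    = a * s ^+ 2 + 2 * s * (z *m u^T) 0 0 + (z *m D *m z^T) 0 0.
  rewrite eA mul_row_block tr_row_mx mul_row_col !mulmxDl tr_scalar_mx.
  rewrite -!scalar_mxM -mulmxA !mul_scalar_mx !mul_mx_scalar.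
  rewrite -scalemxAl -scalemxAr.
  have -> : (u *m z^T) = (z *m u^T)^T by rewrite trmx_mul trmxK.
  move: (z *m u^T) (z *m D *m z^T) => p q.
  by rewrite !mxE /= mulr1n; ring.
have a0 : 0 < a.
  have := posA (row_mx 1%:M 0).
  rewrite (qf 1 0) !mul0mx !mxE !expr1n !mulr1 mulr0 !addr0; apply.
  apply/eqP => /matrixP/(_ 0 0); rewrite !mxE.
  case: splitP => // j; rewrite !ord1 => _; rewrite !mxE eqxx => /eqP.
  by rewrite oner_eq0.
have posS (z : 'rV[R]_n) : z != 0 ->
    0 < (z *m (D - a^-1 *: (u^T *m u)) *m z^T) 0 0.
  move=> z0; set q := (z *m u^T) 0 0.
  (* The first coordinate [- q / a] minimizes the quadratic form for fixed [z]; the minimal value is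
     the Schur complement's form at [z]. *)
  have := posA (row_mx (- (a^-1 * q))%:M z).
  rewrite qf -/q => H.
  have {}H : 0 < a * (- (a^-1 * q)) ^+ 2 + 2 * - (a^-1 * q) * q + (z *m D *m z^T) 0 0.
    apply: H; apply: contraNneq z0 => /(congr1 (@rsubmx R 1 1 n)).
    by rewrite row_mxKr linear0 => ->.
  have qq : (z *m (u^T *m u) *m z^T) 0 0 = q ^+ 2.
    rewrite mulmxA -mulmxA mxE big_ord1 -/q expr2; congr (_ * _).
    by rewrite /q -[RHS](trace_mx11) -mxtrace_tr trmx_mul trmxK trace_mx11.
  rewrite mulmxBr mulmxBl -scalemxAr -scalemxAl [X in 0 < X]mxE.
  rewrite [X in _ + X]mxE [X in - X]mxE qq; apply: lt_le_trans H _.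
  rewrite le_eqVlt; apply/orP; left; apply/eqP; field.
  by rewrite gt_eqF.
have symS : (D - a^-1 *: (u^T *m u))^T = D - a^-1 *: (u^T *m u).
  by rewrite linearB /= linearZ /= trmx_mul trmxK symD.
have [L eL] := IH _ symS posS.
(* One more row of an upper triangular factor: its first row is that of [A] divided by [sqrt a]. *)
pose L' : 'M[R]_(1 + n) := block_mx (Num.sqrt a)%:M ((Num.sqrt a)^-1 *: u) 0 L.
suff : A' = L'^T *m L' by exists L'.
rewrite eA tr_block_mx mulmx_block !trmx0 !mul0mx !mulmx0 !addr0 tr_scalar_mx.
rewrite -eL; congr block_mx.
- by rewrite -scalar_mxM -expr2 sqr_sqrtr // ltW.
- by rewrite mul_scalar_mx scalerA divff ?scale1r // gt_eqF // sqrtr_gt0.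
- by rewrite linearZ /= mul_mx_scalar scalerA divff ?scale1r // gt_eqF // sqrtr_gt0.
- rewrite -scalemxAr [(_ *: u)^T]linearZ /= -scalemxAl scalerA -invfM -expr2.
  by rewrite sqr_sqrtr ?ltW // addrC subrK.
Qed.

(** With A = L^T L, cyclicity turns the trace into that of L B L^T, which sums the quadratic form of
    [B] over the rows of [L]. *)
Lemma trace_posdef_mul_ge0 (R : rcfType) (n : nat) (A B : 'M[R]_n) :
  A^T = A -> (forall xi : 'rV[R]_n, xi != 0 -> 0 < (xi *m A *m xi^T) 0 0) ->
  (forall xi : 'rV[R]_n, 0 <= (xi *m B *m xi^T) 0 0) -> 0 <= \tr (A *m B).
Proof.
move=> symA posA psdB; have [L ->] := sym_posdef_factor symA posA.
rewrite -mulmxA mxtrace_mulC; apply: sumr_ge0 => i _.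
have := psdB (row i L); congr (0 <= _).
by rewrite -row_mul tr_row -!row_mul !mxE; apply: eq_bigr => j _; rewrite !mxE.
Qed.

(** * Directional derivatives and one-variable extrema *)

(** The two difference quotients are the same function of the increment. This reduces questions
    about directions to calculus on the real line. *)
Lemma is_derive_line (R : realType) (V : normedModType R) (f : V -> R) x v
    (h d : R) : is_derive (h *: v + x) v f d <->
  is_derive h (1 : R) (fun s : R => f (s *: v + x)) d.
Proof.
have E : (fun k : R => k^-1 *:
      (((fun s : R => f (s *: v + x)) \o shift h) (k *: 1) - f (h *: v + x)))
    = (fun k : R => k^-1 *:
      ((f \o shift (h *: v + x)) (k *: v) - f (h *: v + x))).
  by apply/funext => k /=; rewrite addrA -scalerDl [k *: 1]mulr1.
split=> -[D Dv]; split.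
- by rewrite /derivable E.
- by rewrite /derive E.
- by move: D; rewrite /derivable E.
- by move: Dv; rewrite /derive E.
Qed.

Lemma is_derive_epsP (R : realType) (V : normedModType R) (f : V -> R) x v
    (d : R) : is_derive x v f d <->
  forall e, 0 < e -> exists2 r, 0 < r &
    forall h : R, h != 0 -> `|h| < r ->
      `|h^-1 * (f (h *: v + x) - f x) - d| < e.
Proof.
have -> : is_derive x v f d <->
    (h^-1 *: ((f \o shift x) (h *: v) - f x) @[h --> 0^'] --> d).
  split=> [[D <-]|D]; first exact: D.
  by split; [apply/cvg_ex; exists d|exact: cvg_lim D].
split=> [/cvgrPdist_lt D e e0|D].
  have /nbhs_ballP[r /= r0 rP] := D e e0; exists r => // h h0 hr.
  by rewrite distrC; apply: rP => //; rewrite -ball_normE /= sub0r normrN.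
apply/cvgrPdist_lt => e /D[r r0 rP].
apply/nbhs_ballP; exists r => // h; rewrite -ball_normE /= sub0r normrN => hr h0.
by rewrite distrC; exact: rP.
Qed.

Lemma is_derive_gt0_near (R : realType) (f : R -> R) (x d : R) :
  is_derive x 1 f d -> 0 < d ->
  exists2 e, 0 < e & forall h, 0 < h < e -> f (x - h) < f x < f (x + h).
Proof.
move=> /is_derive_epsP D d0; have [e e0 H] := D d d0; exists e => // h /andP[h0 he].
have hn : h != 0 by rewrite gt_eqF.
have := H h hn; rewrite gtr0_norm // => /(_ he); rewrite ltr_norml => /andP[+ _].
have := H (- h); rewrite oppr_eq0 hn normrN gtr0_norm // => /(_ isT he).
rewrite ltr_norml => /andP[+ _].
rewrite !ltrBrDr !addNr invrN mulNr ![_ *: 1]mulr1 ![_ + x]addrC oppr_gt0.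
by rewrite pmulr_rlt0 ?pmulr_rgt0 ?invr_gt0 // subr_gt0 subr_lt0 => -> ->.
Qed.

(** Used in the time variable: the maximum may sit on the top of the cylinder, where only earlier
    times can be compared and only a sign of the derivative is available. *)
Lemma left_max_derive_ge0 (R : realType) (f : R -> R) (a x d : R) :
  a < x -> is_derive x 1 f d -> (forall s, a <= s <= x -> f s <= f x) -> 0 <= d.
Proof.
move=> ax fd fmax; rewrite leNgt; apply/negP => d0.
have : is_derive x 1 (- f) (- d) by exact: is_deriveN.
move=> /is_derive_gt0_near; rewrite oppr_gt0 => /(_ d0)[e e0 H].
pose h := Num.min (e / 2) (x - a).
have h0 : 0 < h by rewrite lt_min divr_gt0 // subr_gt0.
have he : h < e by rewrite gt_min; apply/orP; left; lra.
have ha : h <= x - a by rewrite ge_min lexx orbT.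
have /andP[+ _] := H h (introT andP (conj h0 he)).
by rewrite ltNge; apply/negP; rewrite negbK lerN2; apply: fmax; lra.
Qed.

(** [G] is the derivative of [g] near 0 and vanishes at the maximum. If [c] were positive, [G] would
    be positive just to the right of 0, and the mean value theorem would make [g] exceed [g 0]
    there. *)
Lemma second_derivative_test (R : realType) (g G : R -> R) (c : R) :
  (\forall h \near (0 : R), is_derive h (1 : R) g (G h)) -> is_derive (0 : R) (1 : R) G c ->
  (\forall h \near (0 : R), g h <= g 0) -> G 0 = 0 /\ c <= 0.
Proof.
move=> /nbhs_ballP[r /= r0 gG] Gc /nbhs_ballP[r' /= r'0 gmax].
have bE (s t : R) : `|t| < s -> ball (0 : R) s t.
  by rewrite -ball_normE /= sub0r normrN.
have gG' s : `|s| < r -> is_derive s (1 : R) g (G s) by move/bE/gG.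
have G00 : G 0 = 0.
  have g0 : is_derive (0 : R) (1 : R) g (G 0) by apply: gG'; rewrite normr0.
  have gmin e : 0 < e -> exists2 h, 0 < h < e & g (- h) <= g 0 /\ g h <= g 0.
    move=> e0; pose h := Num.min (e / 2) (r' / 2).
    have h0 : 0 < h by rewrite lt_min !divr_gt0.
    have he : h < e by rewrite gt_min; apply/orP; left; lra.
    have hr : h < r' by rewrite gt_min; apply/orP; right; lra.
    by exists h; rewrite ?h0 //; split; apply: gmax; apply: bE;
      rewrite ?normrN gtr0_norm.
  have [G_lt0|G_gt0|//] := ltgtP (G 0) 0.
    have : is_derive (0 : R) (1 : R) (- g) (- G 0) by exact: is_deriveN.
    move=> /is_derive_gt0_near; rewrite oppr_gt0 => /(_ G_lt0)[e e0 H].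
    have [h /H /andP[+ _] [gh _]] := gmin e e0.
    by rewrite sub0r ltNge lerN2 gh.
  have [e e0 H] := is_derive_gt0_near g0 G_gt0.
  have [h /H /andP[_ +] [_ gh]] := gmin e e0.
  by rewrite add0r ltNge gh.
split=> //; rewrite leNgt; apply/negP => c0.
have [e e0 H] := is_derive_gt0_near Gc c0.
pose h := Num.min (e / 2) (Num.min (r / 2) (r' / 2)).
have h0 : 0 < h by rewrite !lt_min !divr_gt0.
have he : h < e by rewrite gt_min; apply/orP; left; lra.
have hr : h < r by rewrite !gt_min; apply/orP; right; apply/orP; left; lra.
have hr' : h < r' by rewrite !gt_min; apply/orP; right; apply/orP; right; lra.
have gD s : s \in `]0, h[%R -> is_derive s (1 : R) g (G s).
  rewrite in_itv /= => /andP[s0 sh]; apply: gG'.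
  by rewrite gtr0_norm // (lt_trans sh).
have gC : {within `[0, h], continuous g}.
  apply: derivable_within_continuous => s; rewrite in_itv /= => /andP[s0 sh].
  by apply: (@ex_derive _ _ _ _ _ _ (G s)); apply: gG'; rewrite ger0_norm // (le_lt_trans sh).
have [s + gs] := MVT h0 gD gC.
rewrite in_itv /= => /andP[s0 sh].
have : g h <= g 0 by apply: gmax; apply: bE; rewrite gtr0_norm.
rewrite leNgt -subr_gt0 gs subr0 mulr_gt0 //.
by have := H s; rewrite s0 (lt_trans sh he) G00 !add0r => /(_ isT)/andP[].
Qed.

(** The mean value theorem between 0 and [c] for either sign of [c], so that increments need no case
    distinction later. *)
Lemma MVT_norm (R : realType) (f df : R -> R) (c : R) :
  (forall s, `|s| <= `|c| -> is_derive s (1 : R) f (df s)) ->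
  exists2 s, `|s| <= `|c| & f c - f 0 = df s * c.
Proof.
move=> fd.
have cf a b : (forall s, a <= s <= b -> `|s| <= `|c|) ->
    {within `[a, b], continuous f}.
  move=> H; apply: derivable_within_continuous => s; rewrite in_itv /= => sab.
  by apply: (@ex_derive _ _ _ _ _ _ (df s)); apply/fd/H.
have [c0|c0] := leP 0 c.
  have H s : 0 <= s <= c -> `|s| <= `|c|.
    by case/andP=> s0 sc; rewrite !ger0_norm // (le_trans s0).
  have [s|s sI E] := @MVT_segment R f df 0 c c0 _ (cf _ _ H).
    by rewrite in_itv /= => /andP[s0 sc]; apply/fd/H; rewrite !ltW.
  by exists s; [apply: H; rewrite in_itv in sI|rewrite E subr0].
have H s : c <= s <= 0 -> `|s| <= `|c|.
  by case/andP=> sc s0; rewrite !ler0_norm ?lerN2 // (le_trans sc).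
have [s|s sI E] := @MVT_segment R f df c 0 (ltW c0) _ (cf _ _ H).
  by rewrite in_itv /= => /andP[s0 sc]; apply/fd/H; rewrite !ltW.
exists s; first by apply: H; rewrite in_itv in sI.
by rewrite -opprB E sub0r mulrN opprK.
Qed.

(** The increment along [u + c *: v] is split into a move along [u] and then one along [v]. The mean
    value theorem rewrites the second as [c] times ['D_v f] at a nearby point, and continuity of
    ['D_v f] at [x] gives the limit. *)
Lemma is_derive_addv (R : realType) (V : normedModType R) (f : V -> R)
    (x u v : V) (c a : R) :
  is_derive x u f a -> (\forall y \near x, derivable f y v) ->
  {for x, continuous ('D_v f)} ->
  is_derive x (u + c *: v) f (a + c * 'D_v f x).
Proof.
move=> /is_derive_epsP fu fv cv; apply/is_derive_epsP => e e0.
have [r1 r10 H1] := fu (e / 2) (divr_gt0 e0 (ltr0n _ 2)).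
(* Adding 1 to [|c|] keeps the tolerance e / (2 (|c| + 1)) meaningful when [c] is 0. *)
have c1 : 0 < 2 * (`|c| + 1) by rewrite mulr_gt0 // ltr_wpDl.
have : \forall y \near x, derivable f y v /\
    `|'D_v f x - 'D_v f y| < e / (2 * (`|c| + 1)).
  apply: filterI => //.
  by move/cvgrPdist_lt : cv; apply; rewrite divr_gt0.
move=> /nbhs_ballP[r2 /= r20 H2].
(* [|h| * N] bounds the distance from [x] of every intermediate point; the summand 1 makes [N]
   positive. *)
pose N := `|u| + `|c| * `|v| + 1.
have N0 : 0 < N by rewrite /N ltr_wpDl // addr_ge0 // mulr_ge0.
exists (Num.min r1 (r2 / N)); first by rewrite lt_min r10 divr_gt0.
move=> h h0; rewrite lt_min ltr_pdivlMr // => /andP[h1 h2].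
have inB s : `|s| <= `|h * c| -> ball x r2 (s *: v + (h *: u + x)).
  move=> sh; rewrite -ball_normE /= distrC addrA addrK.
  apply: le_lt_trans h2; apply: le_trans (ler_normD _ _) _.
  rewrite !normrZ /N; have := ler_wpM2r (normr_ge0 v) sh; rewrite normrM.
  by have := normr_ge0 h; lra.
have fl s : `|s| <= `|h * c| -> is_derive s (1 : R)
    (fun s => f (s *: v + (h *: u + x))) ('D_v f (s *: v + (h *: u + x))).
  by move=> /inB/H2[+ _] => /derivableP/is_derive_line.
have [s sh] := MVT_norm fl; rewrite scale0r add0r => E.
have [_ Ds] := H2 _ (inB s sh).
have -> : h *: (u + c *: v) + x = (h * c) *: v + (h *: u + x).
  by rewrite scalerDr scalerA addrAC addrC addrA.
have -> : h^-1 * (f ((h * c) *: v + (h *: u + x)) - f x) - (a + c * 'D_v f x)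
    = h^-1 * (f (h *: u + x) - f x) - a
      + c * ('D_v f (s *: v + (h *: u + x)) - 'D_v f x).
  by rewrite -(subrK (f (h *: u + x)) (f ((h * c) *: v + _))) E; field.
apply: le_lt_trans (ler_normD _ _) _; rewrite (splitr e).
apply: ltr_leD; first exact: H1.
rewrite normrM distrC; apply: le_trans (ler_wpM2l _ (ltW Ds)) _ => //.
rewrite mulrA ler_pdivrMr // [_ * e]mulrC -mulrA ler_wpM2l ?ltW //.
by rewrite mulKf // ; have := normr_ge0 c; lra.
Qed.

(** The direction [xi] is expanded in the standard basis, and [is_derive_addv] adds one coordinate
    at a time, starting from the zero direction. *)
Lemma is_derive_partials (R : realType) (n : nat) (f : 'rV[R]_n -> R)
    (x xi : 'rV[R]_n) :
  (forall i, \forall z \near x, derivable f z (basis_vec i)) ->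
  (forall i, {for x, continuous ('D_(basis_vec i) f)}) ->
  is_derive x xi f (\sum_i xi 0 i * 'D_(basis_vec i) f x).
Proof.
move=> fd fc; rewrite [xi in is_derive _ xi]row_sum_delta.
elim: (index_enum _) => [|i s IH]; first by rewrite !big_nil; exact: is_derive0.
rewrite !big_cons addrC [X in is_derive _ _ _ X]addrC.
by apply: is_derive_addv => //; [exact: fd|exact: fc].
Qed.

(** * The Euclidean inner product and norm *)

Lemma dotE (R : realType) n (u v : 'rV[R]_n) : dot u v = \sum_i u 0 i * v 0 i.
Proof. by rewrite /dot mxE; apply: eq_bigr => i _; rewrite mxE. Qed.

Lemma dotC (R : realType) n (u v : 'rV[R]_n) : dot u v = dot v u.
Proof. by rewrite !dotE; apply: eq_bigr => i _; rewrite mulrC. Qed.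

Lemma dotDl (R : realType) n (u v z : 'rV[R]_n) :
  dot (u + v) z = dot u z + dot v z.
Proof. by rewrite /dot mulmxDl mxE. Qed.

Lemma dotZl (R : realType) n (c : R) (u z : 'rV[R]_n) :
  dot (c *: u) z = c * dot u z.
Proof. by rewrite /dot -scalemxAl mxE. Qed.

Lemma dot_ge0 (R : realType) n (u : 'rV[R]_n) : 0 <= dot u u.
Proof. by rewrite dotE; apply: sumr_ge0 => i _; rewrite -expr2 sqr_ge0. Qed.

Lemma dot_eq0 (R : realType) n (u : 'rV[R]_n) : (dot u u == 0) = (u == 0).
Proof.
apply/eqP/eqP => [|->]; last by rewrite /dot mul0mx mxE.
rewrite dotE => /eqP; rewrite psumr_eq0 => [|i _]; last by rewrite -expr2 sqr_ge0.
move=> /allP u0; apply/rowP => i; rewrite mxE; apply/eqP.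
by have := u0 i (mem_index_enum i); rewrite mulf_eq0 orbb.
Qed.

Lemma enorm_ge0 (R : realType) n (u : 'rV[R]_n) : 0 <= enorm u.
Proof. exact: sqrtr_ge0. Qed.

Lemma sqr_enorm (R : realType) n (u : 'rV[R]_n) : enorm u ^+ 2 = dot u u.
Proof. by rewrite sqr_sqrtr // dot_ge0. Qed.

Lemma dot_cauchy_schwarz (R : realType) n (u v : 'rV[R]_n) :
  `|dot u v| <= enorm u * enorm v.
Proof.
rewrite -sqrtr_sqr /enorm -sqrtrM ?dot_ge0 // ler_wsqrtr //.
have [->|v0] := eqVneq v 0; first by rewrite dotC /dot !mul0mx mxE mulr0 expr0n.
have q0 : 0 < dot v v by rewrite lt_neqAle eq_sym dot_eq0 v0 dot_ge0.
rewrite -subr_ge0 -(pmulr_rge0 _ q0).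
(* Up to the factor [dot v v], this vector is the component of [u] orthogonal to [v]; its squared
   length is [dot v v] times the difference to be bounded. *)
have := dot_ge0 (dot v v *: u - dot u v *: v).
rewrite -scaleNr !(dotDl, dotZl) ![dot _ (_ + _)]dotC !(dotDl, dotZl) [dot v u]dotC.
by congr (0 <= _); ring.
Qed.

(** * Spatial maxima of a function plus a Gaussian *)

Lemma is_derive_cmul (R : realType) (f : R -> R) (K x d : R) :
  is_derive x (1 : R) f d -> is_derive x (1 : R) (fun s => K * f s) (K * d).
Proof. by move=> H; exact: (is_deriveZ K). Qed.

Lemma is_derive_expR_quadratic (R : realType) (a b c h : R) :
  is_derive h (1 : R) (fun s => expR (a + s * b + s ^+ 2 * c))
    (expR (a + h * b + h ^+ 2 * c) * (b + 2 * h * c)).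
Proof.
have D : is_derive h (1 : R) (fun s => a + s * b + s ^+ 2 * c) (b + 2 * h * c).
  have Di := is_derive_id h (1 : R).
  have := is_deriveD (is_deriveD (is_derive_cst a h (1 : R)) (is_derive_cmul b Di))
    (is_derive_cmul c (is_deriveM Di Di)).
  rewrite (_ : _ + _ + _ = (fun s => a + s * b + s ^+ 2 * c)); last first.
    by apply/funext => s; rewrite !fctE; ring.
  by move=> /is_derive_eq; apply; rewrite add0r /GRing.scale /=; ring.
by apply: is_derive_eq (is_derive1_comp (is_derive_expR _) D) _; rewrite mulrC.
Qed.

(** On the line through [x] in direction [xi] the Gaussian becomes the exponential of a quadratic
    polynomial. The one-variable test then yields the first-order identity and the second-order
    inequality for each [xi]. *)
Lemma max_add_gaussian (R : realType) n (U : set 'rV[R]_n) (f : 'rV[R]_n -> R)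
    (x y : 'rV[R]_n) (K al ga : R) :
  let D i := 'D_(basis_vec i) f in
  let P := K * expR (al - ga * dot (x - y) (x - y)) in
  open U -> U x ->
  (forall i z, U z -> derivable f z (basis_vec i)) ->
  (forall i z, U z -> {for z, continuous (D i)}) ->
  (forall i j z, U z -> derivable (D j) z (basis_vec i)) ->
  (forall i j z, U z -> {for z, continuous ('D_(basis_vec i) (D j))}) ->
  (forall z, U z -> f z + K * expR (al - ga * dot (z - y) (z - y)) <= f x + P) ->
  forall xi : 'rV[R]_n,
    \sum_i xi 0 i * D i x = P * (2 * ga * dot xi (x - y)) /\
    \sum_j xi 0 j * (\sum_i xi 0 i * 'D_(basis_vec i) (D j) x)
      + P * ((2 * ga * dot xi (x - y)) ^+ 2 - 2 * ga * dot xi xi) <= 0.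
Proof.
move=> D P oU Ux fd fc fd2 fc2 fmax xi.
have near_all (Q : 'rV[R]_n -> Prop) : (forall z, U z -> Q z) ->
    forall z, U z -> \forall z' \near z, Q z'.
  by move=> H z Uz; apply: filterS H _; exact: open_nbhs_nbhs.
have Uh : \forall h \near (0 : R), U (h *: xi + x).
  have /(_ U) : (fun h : R => h *: xi + x) @ (0 : R) --> (fun h : R => h *: xi + x) 0.
    by apply: cvgD; [exact: scalel_continuous|exact: cvg_cst].
  by apply; rewrite scale0r add0r; exact: open_nbhs_nbhs.
(* [a], [b], [c] are the coefficients of the Gaussian's exponent as a polynomial in the line
   parameter [h]. *)
pose a := al - ga * dot (x - y) (x - y).
pose b := - (ga * 2 * dot xi (x - y)); pose c := - (ga * dot xi xi).
pose Q h := expR (a + h * b + h ^+ 2 * c).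
have QE h : expR (al - ga * dot (h *: xi + x - y) (h *: xi + x - y)) = Q h.
  congr expR; rewrite /a /b /c -addrA; move: (x - y) => v.
  rewrite !(dotDl, dotZl) ![dot _ (_ + v)]dotC !(dotDl, dotZl) [dot v xi]dotC.
  by ring.
have Q0 : K * Q 0 = P by rewrite -QE scale0r add0r.
pose G (h : R) := \sum_i xi 0 i * D i (h *: xi + x) + K * (Q h * (b + 2 * h * c)).
have dQ h : is_derive h (1 : R) Q (Q h * (b + 2 * h * c)).
  exact: is_derive_expR_quadratic.
have [|||G0 H] := @second_derivative_test R
    (fun h => f (h *: xi + x) + K * Q h) G
    (\sum_j xi 0 j * (\sum_i xi 0 i * 'D_(basis_vec i) (D j) x)
     + K * (Q 0 * (b ^+ 2 + 2 * c))).
- apply: filterS Uh => h Uhx.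
  have df : is_derive (h *: xi + x) xi f (\sum_i xi 0 i * D i (h *: xi + x)).
    by apply: is_derive_partials => i; [exact: near_all (fd i) _ Uhx|exact: fc].
  apply: is_deriveD (is_derive_cmul K (dQ h)).
  exact: ((is_derive_line f x xi h _).1 df).
- have dl : is_derive (0 : R) (1 : R) (fun h => b + 2 * h * c) (2 * c).
    have := is_deriveD (is_derive_cst b (0 : R) (1 : R))
      (is_derive_cmul (2 * c) (is_derive_id (0 : R) (1 : R))).
    rewrite (_ : cst b + _ = (fun h => b + 2 * h * c)); last first.
      by apply/funext => h; rewrite !fctE; ring.
    by rewrite add0r mulr1.
  have dQ2 : is_derive (0 : R) (1 : R) (fun h => Q h * (b + 2 * h * c))
      (Q 0 * (b ^+ 2 + 2 * c)).
    apply: is_derive_eq (is_deriveM (dQ 0) dl) _.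
    by rewrite /GRing.scale /=; ring.
  apply: is_deriveD (is_derive_cmul K dQ2).
  rewrite (_ : (fun h => _) = \sum_i (fun h : R => xi 0 i * D i (h *: xi + x))); last first.
    by apply/funext => h; rewrite fct_sumE.
  apply: is_derive_sum => j; apply: is_derive_cmul.
  have df2 : is_derive x xi (D j) (\sum_i xi 0 i * 'D_(basis_vec i) (D j) x).
    by apply: is_derive_partials => i; [exact: near_all (fd2 i j) _ Ux|exact: fc2].
  by apply: (is_derive_line (D j) x xi 0 _).1; rewrite scale0r add0r.
- apply: filterS Uh => h Uhx; rewrite -QE [in leRHS]Q0 scale0r add0r.
  exact: fmax.
split.
  move: G0; rewrite /G scale0r add0r mulr0 mul0r addr0 mulrA Q0 /b => /eqP.
  by rewrite addr_eq0 => /eqP ->; ring.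
move: H; rewrite mulrA Q0; congr (_ + _ <= _); rewrite /b /c; ring.
Qed.

Lemma cont_on_section (R : realType) n (U : set 'rV[R]_n) (I : set R)
    (w : 'rV[R]_n -> R -> R) (x : 'rV[R]_n) (t : R) :
  open U -> open I -> U x -> I t -> cont_on (U `*` I) w ->
  {for x, continuous (w ^~ t)}.
Proof.
move=> oU oI Ux It cw.
have oUI : open (U `*` I).
  rewrite openE => -[p q] /= [Up Iq]; exists (U, I) => //=.
  by split; exact: open_nbhs_nbhs.
have ct : {for (x, t), continuous (fun p : 'rV[R]_n * R => w p.1 p.2)}.
  by have := cw; rewrite /cont_on continuous_open_subspace //; apply; rewrite inE.
have cx : (fun z => (z, t)) @ x --> (x, t).
  exact: (cvg_pair (cvg_id : id @ x --> x) (cvg_cst t)).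
exact: (cvg_comp _ _ cx ct).
Qed.

(** * The barrier and the exclusion of interior maxima *)

(** For s > 0 this is s^(-be) exp (al - |x - y|^2 / (4 c s)), a heat kernel of diffusivity [c] up to
    a constant, with [be] in place of n/2. *)
Definition barrier (R : realType) n (al be c : R) (y x : 'rV[R]_n) (s : R) : R :=
  expR (al - be * ln s - (4 * c * s)^-1 * dot (x - y) (x - y)).

Lemma is_derive_barrier (R : realType) n (al be c : R) (y x : 'rV[R]_n) (s : R) :
  0 < c -> 0 < s ->
  is_derive s (1 : R) (barrier al be c y x)
    (barrier al be c y x s
     * (- (be / s) + (4 * c * s)^-1 / s * dot (x - y) (x - y))).
Proof.
move=> c0 s0; set q := dot _ _.
have Dl : is_derive s (1 : R) (fun s => - be * ln s) (- be * s^-1).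
  exact/is_derive_cmul/is_derive1_ln.
have Di : is_derive s (1 : R) (fun s : R => - (q / (4 * c)) * s^-1)
    (- (q / (4 * c)) * (- s ^- 2)).
  apply: is_derive_cmul.
  have s00 : s != 0 by rewrite gt_eqF.
  apply: is_derive_eq (is_deriveV s00 (is_derive_id s (1 : R))) _.
  by rewrite [_ *: 1]mulr1.
have D : is_derive s (1 : R) (fun s => al - be * ln s - (4 * c * s)^-1 * q)
    (- (be / s) + (4 * c * s)^-1 / s * q).
  have := is_deriveD (is_derive_cst al s (1 : R)) (is_deriveD Dl Di).
  rewrite (_ : cst al + _ = (fun s => al - be * ln s - (4 * c * s)^-1 * q)); last first.
    by apply/funext => z; rewrite !fctE [(4 * c * z)^-1]invfM; ring.
  move=> /is_derive_eq; apply; rewrite add0r.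
  by field; rewrite !gt_eqF.
by apply: is_derive_eq (is_derive1_comp (is_derive_expR _) D) _; rewrite mulrC.
Qed.

(* At an interior maximum the second derivative test is applied along every line
   through x, so that only directional derivatives of w and of the barrier occur. *)
Lemma no_interior_max (R : realType) n (U : set 'rV[R]_n)
    (A : 'rV[R]_n -> R -> 'M[R]_n) (b : 'rV[R]_n -> R -> 'rV[R]_n)
    (w : 'rV[R]_n -> R -> R) (I F : R -> R) (y : 'rV[R]_n)
    (T0 a t c M m Rk al be de K e : R) (x : 'rV[R]_n) :
  let psi x t := w x t - I t + K * barrier al be c y x (t - a + de)
                 - e * (t - a) in
  open U -> U x -> T0 <= a -> a < t -> 0 < c -> 0 < de -> 0 <= K -> 0 < e ->
  M + m * Rk = 2 * c * be -> enorm (x - y) <= Rk ->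
  (A x t)^T = A x t ->
  (forall xi : 'rV[R]_n, c * enorm xi ^+ 2 <= (xi *m A x t *m xi^T) 0 0) ->
  \tr (A x t) <= M -> enorm (b x t) <= m ->
  C21 U `]T0, +oo[ w -> Ltilde A b w x t <= F t ->
  is_derive t (1 : R) I (F t) ->
  (forall z, U z -> psi z t <= psi x t) ->
  (forall s, a <= s <= t -> psi x s <= psi x t) -> False.
Proof.
move=> psi oU Ux T0a at_ c0 de0 K0 e0 Mbe xR symA ellA trA bm
  [_ [w_t _] w_x w_xx] Lw dI max_x max_t.
have T0t : `]T0, +oo[%classic t by rewrite /= in_itv /= andbT (le_lt_trans T0a).
have oT : open `]T0, +oo[%classic by exact: interval_open.
pose s := t - a + de; have s0 : 0 < s by rewrite addr_gt0 // subr_gt0.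
pose ga := (4 * c * s)^-1.
have ga0 : 0 < ga by rewrite invr_gt0 !mulr_gt0.
pose v := x - y; pose P := K * barrier al be c y x s.
have P0 : 0 <= P by rewrite mulr_ge0 // expR_ge0.
(* Here [x] is fixed and [psi x] has its maximum over [a, t] at the right end. *)
have time : 0 <= dt w x t - F t + P * (- (be / s) + ga / s * dot v v) - e.
  apply: (left_max_derive_ge0 at_ _ max_t).
  have Db : is_derive t (1 : R) (fun t => barrier al be c y x (t - a + de))
      (barrier al be c y x s * (- (be / s) + ga / s * dot v v)).
    have := (is_derive_line (barrier al be c y x) (- a + de) 1 t _).1.
    rewrite (_ : (fun _ => _) = (fun t => barrier al be c y x (t - a + de))); last first.
      by apply/funext => z; rewrite [z *: 1]mulr1 addrA.
    apply; rewrite [_ *: 1]mulr1 addrA.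
    exact: is_derive_barrier.
  have De : is_derive t (1 : R) (fun t => e * (t - a)) (e * 1).
    apply: is_derive_cmul; rewrite (_ : (fun _ => _) = id - cst a) //.
    by apply: is_derive_eq; rewrite subr0.
  have Dw : is_derive t (1 : R) (w x) (dt w x t).
    by rewrite /dt derive1E; apply: derivableP; exact: w_t.
  have := is_deriveB (is_deriveD (is_deriveB Dw dI) (is_derive_cmul K Db)) De.
  by rewrite mulr1 mulrA.
(* At fixed time the barrier is a Gaussian in [x]: the power of [s] is absorbed into the constant
   [al - be * ln s], and the terms of [psi] that depend on time alone cancel. *)
have space xi := max_add_gaussian (f := w ^~ t) (x := x) (y := y) (K := K)
  (al := al - be * ln s) (ga := ga) oU Ux _ _ _ _ _ xi.
have {}space (xi : 'rV[R]_n) :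
    \sum_i xi 0 i * dx i w x t = P * (2 * ga * dot xi v) /\
    \sum_j xi 0 j * (\sum_i xi 0 i * dx i (dx j w) x t)
      + P * ((2 * ga * dot xi v) ^+ 2 - 2 * ga * dot xi xi) <= 0.
  apply: space.
  - by move=> i z Uz; exact: (w_x i).1.
  - by move=> i z Uz; apply: (cont_on_section oU oT Uz T0t (w_x i).2).
  - by move=> i j z Uz; exact: (w_xx i j).1.
  - by move=> i j z Uz; apply: (cont_on_section oU oT Uz T0t (w_xx i j).2).
  - move=> z /max_x; rewrite /psi /barrier -/s -/ga /P /barrier -/ga; lra.
(* The first-order identity in the direction [xi = b x t] evaluates the drift term. *)
have grad : dot (b x t) (gradx w x t) = P * (2 * ga * dot (b x t) v).
  have [<- _] := space (b x t); rewrite dotE.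
  by apply: eq_bigr => i _; rewrite mxE.
have bv : - (m * Rk) <= dot (b x t) v.
  apply: (le_trans _ (lerNnormlW (dot_cauchy_schwarz (b x t) v))).
  by rewrite lerN2 ler_pM // enorm_ge0.
have posA (xi : 'rV[R]_n) : xi != 0 -> 0 < (xi *m A x t *m xi^T) 0 0.
  move=> xi0; apply: lt_le_trans _ (ellA xi).
  by rewrite sqr_enorm mulr_gt0 // lt_neqAle eq_sym dot_eq0 xi0 dot_ge0.
pose H := hessx w x t.
have qH (xi : 'rV[R]_n) : (xi *m H *m xi^T) 0 0 =
    \sum_j xi 0 j * (\sum_i xi 0 i * dx i (dx j w) x t).
  rewrite mxE; apply: eq_bigr => j _; rewrite !mxE mulrC; congr (_ * _).
  by apply: eq_bigr => i _; rewrite !mxE.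
have vv (xi : 'rV[R]_n) : (xi *m (v^T *m v) *m xi^T) 0 0 = dot xi v ^+ 2.
  by rewrite mulmxA -mulmxA mxE big_ord1 -/(dot _ _) -/(dot _ _) [dot v xi]dotC expr2.
(* The matrix is minus the Hessian of w plus [K] times the barrier; the second-order inequalities
   say that its quadratic form is nonnegative, and it is then paired with [A x t] through the
   trace. *)
have psdN (xi : 'rV[R]_n) :
    0 <= (xi *m (- H - P *: ((2 * ga) ^+ 2 *: (v^T *m v) - (2 * ga)%:M))
    *m xi^T) 0 0.
  have [_] := space xi; rewrite -qH.
  have q0 : (xi *m (2 * ga)%:M *m xi^T) 0 0 = 2 * ga * dot xi xi.
    by rewrite mul_mx_scalar -scalemxAl mxE.
  have -> : (xi *m (- H - P *: ((2 * ga) ^+ 2 *: (v^T *m v) - (2 * ga)%:M)) *m xi^T) 0 0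
     = - (xi *m H *m xi^T) 0 0 - P * ((2 * ga) ^+ 2 * (xi *m (v^T *m v) *m xi^T) 0 0
         - (xi *m (2 * ga)%:M *m xi^T) 0 0).
    move: (v^T *m v) => V.
    rewrite !(mulmxBr, mulmxBl, mulmxN, mulNmx) -!(scalemxAr, scalemxAl).
    rewrite !(mulmxBr, mulmxBl, mulmxN, mulNmx) -!(scalemxAr, scalemxAl).
    move: (xi *m H *m _) (xi *m V *m _) (xi *m (2 * ga)%:M *m _) => B1 B2 B3.
    by rewrite !mxE.
  by rewrite q0 vv -exprMn; lra.
have := trace_posdef_mul_ge0 symA posA psdN.
have -> : \tr (A x t *m (- H - P *: ((2 * ga) ^+ 2 *: (v^T *m v) - (2 * ga)%:M)))
    = - frob (A x t) H - P * ((2 * ga) ^+ 2 * (v *m A x t *m v^T) 0 0 - 2 * ga * \tr (A x t)).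
  have <- : \tr (A x t *m (v^T *m v)) = (v *m A x t *m v^T) 0 0.
    by rewrite mulmxA mxtrace_mulC mulmxA trace_mx11.
  move: (v^T *m v) => V; rewrite /frob symA.
  rewrite mulmxBr mulmxN -scalemxAr mulmxBr -scalemxAr mul_mx_scalar.
  by rewrite !(mxtraceZ, raddfB, raddfN) /= ?(mxtraceZ, raddfB); ring.
move=> tr_ge0.
have {}tr_ge0 : frob (A x t) H <= - P * (ga / s * dot v v - 2 * ga * M).
  (* Ellipticity bounds v A v^T below by c |v|^2, and this identity makes the result match the |v|^2
     term of the time derivative. *)
  have gas : ga / s = (2 * ga) ^+ 2 * c.
    by rewrite /ga; field; rewrite !gt_eqF.
  have : P * (ga / s * dot v v - 2 * ga * M) <=
    P * ((2 * ga) ^+ 2 * (v *m A x t *m v^T) 0 0 - 2 * ga * \tr (A x t)).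
    rewrite ler_wpM2l // lerB //; last by rewrite ler_wpM2l // mulr_ge0 // ltW.
    by rewrite gas -mulrA ler_wpM2l ?sqr_ge0 // -sqr_enorm.
  by lra.
have {}grad : - P * (2 * ga * (m * Rk)) <= dot (b x t) (gradx w x t).
  rewrite grad mulNr -mulrN ler_wpM2l // -mulrN ler_wpM2l // mulr_ge0 //.
  exact: ltW.
move: Lw; rewrite /Ltilde -/H; apply/negP; rewrite -ltNge.
(* The choice of [be] makes the term be / s cancel the trace and drift contributions exactly. What
   remains is Lw >= F + e, against Lw <= F. *)
have E : be / s = 2 * ga * M + 2 * ga * (m * Rk).
  rewrite -mulrDr Mbe /ga; field. 
  by rewrite !gt_eqF.
move: time; rewrite E; lra.
Qed.

(** * Compactness, continuity and the weak maximum principle on a cylinder *)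

Lemma compact_closure_bounded (R : realType) n (U : set 'rV[R]_n) :
  bounded_set U -> compact (closure U).
Proof.
move=> [M [Mr HM]]; apply: bounded_closed_compact; last exact: closed_closure.
have cl : closed [set x : 'rV[R]_n | `|x| <= M + 1].
  have : closed ((fun x : 'rV[R]_n => `|x|) @^-1` [set r : R | r <= M + 1]).
    apply: closed_comp; first by move=> x _; exact: norm_continuous.
    exact: closed_le.
  by [].
exists (M + 1); split.
  by rewrite realE; have [] := leP 0 (M + 1) => // /ltW ->; rewrite orbT.
move=> r Mr1 x Ux; apply: le_trans (ltW Mr1).
suff : closure U `<=` [set x : 'rV[R]_n | `|x| <= M + 1] by apply.
rewrite [X in _ `<=` X](closure_id _).1 //; apply: closure_subset => z Uz.
by apply: HM => //; rewrite ltrDl.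
Qed.

Lemma dot_continuous (R : realType) n (y x : 'rV[R]_n) :
  {for x, continuous (fun z : 'rV[R]_n => dot (z - y) (z - y))}.
Proof.
rewrite (_ : (fun z => _) = (fun z : 'rV[R]_n => \sum_i (z - y) 0 i * (z - y) 0 i)); last first.
  by apply/funext => z; rewrite dotE.
have c i : {for x, continuous (fun z : 'rV[R]_n => (z - y) 0 i)}.
  rewrite (_ : (fun z => _) = (fun z : 'rV[R]_n => z 0 i - y 0 i)); last first.
    by apply/funext => z; rewrite !mxE.
  by apply: continuousB; [exact: coord_continuous|exact: cst_continuous].
elim: (index_enum _) => [|i s IH].
  rewrite (_ : (fun z => _) = cst 0); last by apply/funext => z; rewrite big_nil.
  exact: cst_continuous.
rewrite (_ : (fun z => _) = (fun z : 'rV[R]_n => (z - y) 0 i * (z - y) 0 i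
  + \sum_(i <- s) (z - y) 0 i * (z - y) 0 i)); last first.
  by apply/funext => z; rewrite big_cons.
by apply: continuousD IH; apply: continuousM; exact: c.
Qed.

Lemma barrier_continuous (R : realType) n (al be c d : R) (y : 'rV[R]_n)
    (p : 'rV[R]_n * R) : 0 < c -> 0 < p.2 + d ->
  {for p, continuous (fun p : 'rV[R]_n * R => barrier al be c y p.1 (p.2 + d))}.
Proof.
move=> c0 pd.
have c1 : (fun q : 'rV[R]_n * R => q.2 + d) @ p --> p.2 + d.
  by apply: cvgD; [exact: cvg_snd|exact: cvg_cst].
have c2 : (fun q : 'rV[R]_n * R => dot (q.1 - y) (q.1 - y)) @ p --> dot (p.1 - y) (p.1 - y).
  exact: (cvg_comp _ _ (cvg_fst : fst @ p --> p.1) (@dot_continuous R n y p.1)).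
have c3 : (fun q : 'rV[R]_n * R => ln (q.2 + d)) @ p --> ln (p.2 + d).
  exact: (cvg_comp _ _ c1 (continuous_ln pd)).
have c4 : (fun q : 'rV[R]_n * R => (4 * c * (q.2 + d))^-1) @ p --> (4 * c * (p.2 + d))^-1.
  apply: cvgV; first by rewrite gt_eqF // !mulr_gt0.
  by apply: cvgM => //; exact: cvg_cst.
have c5 : (fun q : 'rV[R]_n * R => al - be * ln (q.2 + d)
     - (4 * c * (q.2 + d))^-1 * dot (q.1 - y) (q.1 - y)) @ p -->
   al - be * ln (p.2 + d) - (4 * c * (p.2 + d))^-1 * dot (p.1 - y) (p.1 - y).
  apply: cvgB; last exact: cvgM.
  by apply: cvgB; [exact: cvg_cst|apply: cvgM => //; exact: cvg_cst].
exact: (cvg_comp _ _ c5 (@continuous_expR R _)).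
Qed.

(** Subtracting a small multiple of t - a makes the differential inequality strict. The maximum over
    the compact cylinder then lies on the bottom or the lateral boundary, where [C] is a bound. *)
Lemma cylinder_comparison (R : realType) n (U : set 'rV[R]_n)
    (A : 'rV[R]_n -> R -> 'M[R]_n) (b : 'rV[R]_n -> R -> 'rV[R]_n)
    (w : 'rV[R]_n -> R -> R) (I F : R -> R) (y : 'rV[R]_n)
    (T0 a e c M m Rk al be de K C : R) :
  let phi x t := w x t - I t + K * barrier al be c y x (t - a + de) in
  open U -> bounded_set U -> T0 <= a -> 0 < c -> 0 < de -> 0 <= K ->
  M + m * Rk = 2 * c * be -> (forall x, U x -> enorm (x - y) <= Rk) ->
  (forall x t, U x -> a < t <= e ->
    [/\ (A x t)^T = A x t,
        forall xi : 'rV[R]_n, c * enorm xi ^+ 2 <= (xi *m A x t *m xi^T) 0 0,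
        \tr (A x t) <= M & enorm (b x t) <= m]) ->
  cont_on (closure U `*` `[a, e]) w -> C21 U `]T0, +oo[ w ->
  (forall x t, U x -> a < t <= e -> Ltilde A b w x t <= F t) ->
  (forall t, a <= t <= e -> is_derive t (1 : R) I (F t)) ->
  (forall x, closure U x -> phi x a <= C) ->
  (forall x t, boundary U x -> a <= t <= e -> phi x t <= C) ->
  forall x t, closure U x -> a <= t <= e -> phi x t <= C.
Proof.
move=> phi oU bU T0a c0 de0 K0 Mbe UR Abnd cw w21 Lw dI phi_a phi_b x1 t1 Ux1 t1ae.
apply/ler_addgt0Pr => eps eps0.
have ae : a <= e by case/andP: t1ae => /le_trans; exact.
(* With this slope the correction e' (t - a) is at most [eps] on [a, e]; the 1 covers the case e =
   a. *)
pose e' := eps / (e - a + 1).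
have ea1 : 0 < e - a + 1 by rewrite ltr_wpDl // subr_ge0.
have e'0 : 0 < e' by rewrite divr_gt0.
pose psi x t := phi x t - e' * (t - a).
pose D := closure U `*` `[a, e].
have cD : compact D.
  by apply: compact_setX; [exact: compact_closure_bounded|exact: segment_compact].
have cpsi : {within D, continuous (fun p : 'rV[R]_n * R => psi p.1 p.2)}.
  apply/subspace_continuousP => p [Up pae].
  have pae' : a <= p.2 <= e by have := pae; rewrite /= in_itv.
  apply: cvgB; last first.
    apply: cvg_within_filter; apply: cvgM; first exact: cvg_cst.
    by apply: cvgB; [exact: cvg_snd|exact: cvg_cst].
  apply: cvgD; last first.
    apply: cvg_within_filter; apply: cvgM; first exact: cvg_cst.
    have H : 0 < p.2 + (- a + de) by case/andP: pae'; lra.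
    rewrite -addrA (_ : (fun _ => _) = (fun q : 'rV[R]_n * R =>
        barrier al be c y q.1 (q.2 + (- a + de)))); last first.
      by apply/funext => q; rewrite addrA.
    exact: (@barrier_continuous R n al be c (- a + de) y p c0 H).
  apply: cvgB; first by move/subspace_continuousP: cw; apply.
  apply: cvg_within_filter.
  have cI : {for p.2, continuous I}.
    by apply/differentiable_continuous/derivable1_diffP; case: (dI _ pae').
  exact: (cvg_comp _ _ (cvg_snd : snd @ p --> p.2) cI).
have D0 : D !=set0 by exists (x1, t1); split => //=; rewrite in_itv.
have [[x0 t0]] := compact_EVT_max D0 cD cpsi.
rewrite inE => -[/= Ux0]; rewrite in_itv /= => t0ae max0.
have max0' x t : closure U x -> a <= t <= e -> psi x t <= psi x0 t0.
  by move=> Ux tae; apply: (max0 (x, t)); rewrite inE; split => //=; rewrite in_itv.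
suff : psi x0 t0 <= C.
  move=> /(le_trans (max0' _ _ Ux1 t1ae)); rewrite /psi lerBlDr => /le_trans; apply.
  rewrite lerD2l /e' mulrAC ler_pdivrMr // ler_wpM2l ?ltW //; lra.
have psi_phi : psi x0 t0 <= phi x0 t0.
  rewrite gerBl; apply: mulr_ge0; first exact: ltW.
  by rewrite subr_ge0; case/andP: t0ae.
apply: le_trans psi_phi _.
(* The maximum point is on the lateral boundary, on the bottom, or at a later time over [U]; the
   third case is contradictory by [no_interior_max]. *)
have [Ux0'|nUx0] := pselect (U x0); last first.
  by apply: phi_b => //; split => // /interior_subset.
have [->|t0a] := eqVneq t0 a; first exact: phi_a.
have at0 : a < t0 by rewrite lt_neqAle eq_sym t0a; case/andP: t0ae.
have t0e : t0 <= e by case/andP: t0ae.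
have at0e : a < t0 <= e by rewrite at0.
have [symA ellA trA bm] := Abnd x0 t0 Ux0' at0e.
exfalso; apply: (no_interior_max (al := al) (y := y) oU Ux0' T0a at0 c0 de0 K0
  e'0 Mbe (UR _ Ux0') symA ellA trA bm w21 (Lw _ _ Ux0' at0e) (dI _ t0ae)).
  by move=> z Uz; apply: max0' => //; exact: subset_closure.
by move=> s /andP[as_ st]; apply: max0' => //; rewrite as_ (le_trans st).
Qed.

(** * A primitive of the right-hand side *)

(** The derivative is two-sided even at [a] and [e]. So [F] is continued to the left of [T0] by its
    value there, and the integral of this continuous extension is differentiated. *)
Lemma exists_primitive (R : realType) (F : R -> R) (T0 a e : R) :
  T0 <= a -> a <= e -> {within `[T0, +oo[, continuous F} ->
  exists I : R -> R, [/\ I a = 0, I e = Rintegral lebesgue_measure `[a, e] F &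
    forall t, a <= t <= e -> is_derive t (1 : R) I (F t)].
Proof.
move=> T0a ae cF; pose G t := F (Num.max T0 t).
have GF t : T0 <= t -> G t = F t by move=> Tt; rewrite /G max_r.
have cG : continuous G.
  move=> t P /= FP.
  have cmax : (fun t => Num.max T0 t) @ t --> Num.max T0 t.
    have := @continuous_max R R (cst T0) id t; apply; last exact: cvg_id.
    exact: cst_continuous.
  have Tm s : `[T0, +oo[%classic (Num.max T0 s).
    by rewrite /= in_itv /= andbT le_max lexx.
  have FP' : nbhs (Num.max T0 t) [set z | `[T0, +oo[%classic z -> P (F z)].
    by move/subspace_continuousP: cF => cF; exact: (cF _ (Tm t) P FP).
  have H : nbhs t [set s | `[T0, +oo[%classic (Num.max T0 s) -> P (F (Num.max T0 s))].
    exact: cmax FP'.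
  suff : nbhs t [set s | P (G s)] by [].
  by apply: filterS H => s /(_ (Tm s)).
have iG u v : lebesgue_measure.-integrable `[u, v] (EFin \o G).
  apply: continuous_compact_integrable; first exact: segment_compact.
  exact: continuous_subspaceT.
(* Starting the integral at a - 1 puts [a] in the interior of the interval of integration; the
   subtracted constant restores I a = 0. *)
pose I t := Rintegral lebesgue_measure `[a - 1, t] G -
  Rintegral lebesgue_measure `[a - 1, a] G.
exists I; split.
- by rewrite /I subrr.
- rewrite /I Rintegral_itvB ?bnd_simp // ?lerBlDr ?lerDl //.
  rewrite Rintegral_itv_obnd_cbnd; last first.
    apply: integrableS (iG a e) => //; apply: subset_itvr; by rewrite bnd_simp.
  apply: eq_Rintegral => t; rewrite inE /= in_itv /= => /andP[at_ _].
  by apply: GF; exact: le_trans at_.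
- move=> t /andP[at_ te].
  have at1 : a - 1 < t by rewrite ltrBlDr (le_lt_trans at_) // ltrDl.
  have tt1 : t < t + 1 by rewrite ltrDl.
  have [D E] := continuous_FTC1_closed tt1 (iG (a - 1) (t + 1)) at1 (cG t).
  have dG : is_derive t (1 : R) (fun t => Rintegral lebesgue_measure `[a - 1, t] G) (F t).
    by split; [exact: D|rewrite -derive1E E GF // (le_trans T0a)].
  have := is_deriveB dG (is_derive_cst (Rintegral lebesgue_measure `[a - 1, a] G) t (1 : R)).
  by rewrite subr0.
Qed.

(** * Maxima and minima over compact sets *)

Lemma setmax_ge0 (R : realType) (S : set R) :
  (forall z, S z -> 0 <= z) -> 0 <= setmax S.
Proof. by move=> S0; rewrite /setmax; case: xgetP => // z _ [/S0]. Qed.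

(** The condition [0 <= c] takes care of the default value 0, which [setmax] has when there is no
    largest element. *)
Lemma setmax_le (R : realType) (S : set R) (c : R) :
  0 <= c -> (forall z, S z -> z <= c) -> setmax S <= c.
Proof. by move=> c0 Sc; rewrite /setmax; case: xgetP => // z _ [/Sc]. Qed.

(** By the extreme value theorem the maximum is attained, so [setmax] is a true maximum and not the
    default value. *)
Lemma compact_le_setmax (R : realType) (X : topologicalType) (D : set X)
    (f : X -> R) (x : X) :
  compact D -> {within D, continuous f} -> D x -> f x <= setmax [set f z | z in D].
Proof.
move=> cD cf Dx; have [z] := compact_EVT_max (ex_intro _ x Dx) cD cf.
rewrite inE => Dz fz.
have : exists v, ([set f z | z in D] `&` ubound [set f z | z in D]) v.
  exists (f z); split; first by exists z.
  by move=> _ [z' Dz' <-]; apply: fz; rewrite inE.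
by move=> /(xgetPex 0)[_]; apply; exists x.
Qed.

(** Attainment is part of the conclusion because the positivity of r_k is read off at a
    minimizer. *)
Lemma compact_setmin (R : realType) (X : topologicalType) (D : set X)
    (f : X -> R) (x : X) :
  compact D -> {within D, continuous f} -> D x ->
  [set f z | z in D] (setmin [set f z | z in D]) /\
  forall z, D z -> setmin [set f z | z in D] <= f z.
Proof.
move=> cD cf Dx; have [z] := compact_EVT_min (ex_intro _ x Dx) cD cf.
rewrite inE => Dz fz.
have : exists v, ([set f z | z in D] `&` lbound [set f z | z in D]) v.
  exists (f z); split; first by exists z.
  by move=> _ [z' Dz' <-]; apply: fz; rewrite inE.
by move=> /(xgetPex 0)[? lb]; split => // z' Dz'; apply: lb; exists z'.
Qed.

Lemma le_setmax_pospart (R : realType) n (D E : set ('rV[R]_n * R))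
    (w : 'rV[R]_n -> R -> R) (p : 'rV[R]_n * R) :
  cont_on D w -> E `<=` D -> compact E -> E p ->
  pospart w p.1 p.2 <= setmax [set pospart w p.1 p.2 | p in E].
Proof.
move=> cw ED cE Ep.
apply: (@compact_le_setmax _ _ E (fun p => pospart w p.1 p.2)) => //.
have cE' := continuous_subspaceW ED cw.
by move=> q; apply: continuous_max; [exact: cst_continuous|exact: cE'].
Qed.

Lemma enormB_continuous (R : realType) n (y : 'rV[R]_n) :
  continuous (fun x : 'rV[R]_n => enorm (x - y)).
Proof.
move=> x; apply: (continuous_comp (@dot_continuous R n y x)).
exact: sqrt_continuous.
Qed.

(** * Upper and lower estimates of the barrier *)

(** With k = r^2 / (4 c be) the exponent is at most be (1 + ln (k/s) - k/s), which is nonpositive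
    since ln u <= u - 1. The constant [al] is thus the one for which the bound 1 is reached at |x -
    y| = r, s = k. *)
Lemma barrier_le1 (R : realType) n (be c r s : R) (x y : 'rV[R]_n) :
  0 < be -> 0 < c -> 0 < r -> 0 < s -> r ^+ 2 <= dot (x - y) (x - y) ->
  barrier (be * (1 + ln (r ^+ 2 / (4 * c * be)))) be c y x s <= 1.
Proof.
move=> be0 c0 r0 s0 rx; rewrite /barrier expR_le1; set k := _ / _.
have k0 : 0 < k by rewrite divr_gt0 ?exprn_gt0 // !mulr_gt0.
have kE : k = r ^+ 2 / (4 * c * be) by [].
clearbody k.
have := @le_ln1Dx R (k / s - 1); rewrite ltrBrDr addNr divr_gt0 // => /(_ isT).
rewrite addrCA subrr addr0 ln_div ?posrE // => lnk.
have := ler_wpM2l (ltW be0) lnk.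
have : be * (k / s) <= (4 * c * s)^-1 * dot (x - y) (x - y).
  apply: le_trans (ler_wpM2l _ rx); last by rewrite invr_ge0 !mulr_ge0 // ltW.
  rewrite le_eqVlt; apply/orP; left; apply/eqP; rewrite kE; field.
  by rewrite !gt_eqF.
lra.
Qed.

(** Half of the term be k/s absorbs the logarithm, by ln u <= u - 1 at u = k/(2s). The other half
    gives exp (-z) <= 1/z with z = be k/(2s), which is linear in [s]. *)
Lemma barrier_small (R : realType) n (be c r s : R) (x y : 'rV[R]_n) :
  0 < be -> 0 < c -> 0 < r -> 0 < s -> r ^+ 2 <= dot (x - y) (x - y) ->
  barrier (be * (1 + ln (r ^+ 2 / (4 * c * be)))) be c y x s
    <= expR (be * ln 2) * (2 / (be * (r ^+ 2 / (4 * c * be)))) * s.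
Proof.
move=> be0 c0 r0 s0 rx; rewrite /barrier; set k := _ / (4 * c * be).
have k0 : 0 < k by rewrite divr_gt0 ?exprn_gt0 // !mulr_gt0.
have kE : k = r ^+ 2 / (4 * c * be) by [].
clearbody k.
have ks0 : 0 < k / s / 2 by apply: divr_gt0 => //; apply: divr_gt0.
have := @le_ln1Dx R (k / s / 2 - 1); rewrite ltrBrDr addNr ks0 => /(_ isT).
rewrite addrCA subrr addr0 !ln_div ?posrE // ?divr_gt0 // => lnk.
have {}lnk := ler_wpM2l (ltW be0) lnk.
have kx : be * (k / s) <= (4 * c * s)^-1 * dot (x - y) (x - y).
  apply: le_trans (ler_wpM2l _ rx); last by rewrite invr_ge0 !mulr_ge0 // ltW.
  rewrite le_eqVlt; apply/orP; left; apply/eqP; rewrite kE; field.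
  by rewrite !gt_eqF.
apply: (@le_trans _ _ (expR (be * ln 2 - be * (k / s / 2)))).
  by rewrite ler_expR; lra.
rewrite expRB -[leRHS]mulrA ler_wpM2l ?expR_ge0 //.
have -> : 2 / (be * k) * s = (be * (k / s / 2))^-1 by field; rewrite !gt_eqF.
have bk0 : 0 < be * (k / s / 2) by rewrite mulr_gt0.
rewrite lef_pV2 ?posrE ?expR_gt0 //; apply: le_trans (expR_ge1Dx _).
by rewrite lerDr.
Qed.

(** At s = tau the Gaussian exponent is at most [be] and k / tau = (r/R)^2, which leaves (r/R)^(2
    be). For s > tau, the bounds ln (s/tau) <= s/tau - 1 and exp (-z) >= 1 - z produce the extra
    factor, the price of the time shift. *)
Lemma barrier_lower (R : realType) n (be c r Rk tau s : R) (x y : 'rV[R]_n) :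
  0 < be -> 0 < c -> 0 < r -> 0 < Rk -> 0 < tau -> tau <= s ->
  4 * c * be * tau = Rk ^+ 2 -> dot (x - y) (x - y) <= Rk ^+ 2 ->
  (r / Rk) `^ (2 * be) * (1 - be * ((s - tau) / tau))
    <= barrier (be * (1 + ln (r ^+ 2 / (4 * c * be)))) be c y x s.
Proof.
move=> be0 c0 r0 Rk0 tau0 taus tauE xR; rewrite /barrier; set k := _ / (4 * c * be).
have s0 : 0 < s by exact: lt_le_trans taus.
have rR0 : 0 < r / Rk by rewrite divr_gt0.
have k0 : 0 < k by rewrite divr_gt0 ?exprn_gt0 // !mulr_gt0.
have kE : k = r ^+ 2 / (4 * c * be) by [].
clearbody k.
have ktE : k / tau = (r / Rk) ^+ 2.
  by rewrite expr_div_n -tauE kE; field; rewrite !gt_eqF.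
have lnkE : ln k = ln tau + 2 * ln (r / Rk).
  by rewrite mulr_natl -lnXn // -ktE ln_div ?posrE // addrCA subrr addr0.
have := @le_ln1Dx R (s / tau - 1); rewrite ltrBrDr addNr divr_gt0 // => /(_ isT).
rewrite addrCA subrr addr0 ln_div ?posrE // => lns.
have {}lns := ler_wpM2l (ltW be0) lns.
have rho : (4 * c * s)^-1 * dot (x - y) (x - y) <= be.
  rewrite mulrC ler_pdivrMr ?mulr_gt0 //; apply: le_trans xR _; rewrite -tauE.
  by rewrite [leRHS]mulrCA mulrC mulrA -subr_ge0; nra.
rewrite {1}/powR gt_eqF // .
apply: (@le_trans _ _ (expR (2 * be * ln (r / Rk)) * expR (- (be * ((s - tau) / tau))))).
  by rewrite ler_wpM2l ?expR_ge0 //; exact: expR_ge1Dx.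
rewrite -expRD ler_expR lnkE mulrBl divff ?gt_eqF //; lra.
Qed.

(** * The two estimates on one cylinder *)

Lemma cylinder_step (R : realType) n (U : set 'rV[R]_n)
    (A : 'rV[R]_n -> R -> 'M[R]_n) (b : 'rV[R]_n -> R -> 'rV[R]_n)
    (w : 'rV[R]_n -> R -> R) (I F : R -> R) (y : 'rV[R]_n)
    (T0 a e c M m r Rk be J G : R) :
  open U -> bounded_set U -> T0 <= a -> a < e -> 0 < c ->
  0 < be -> M + m * Rk = 2 * c * be -> 4 * c * be * (e - a) = Rk ^+ 2 ->
  0 < r -> (forall x, closure U x -> r <= enorm (x - y) <= Rk) -> U !=set0 ->
  (forall x t, U x -> a < t <= e ->
    [/\ (A x t)^T = A x t,
        forall xi : 'rV[R]_n, c * enorm xi ^+ 2 <= (xi *m A x t *m xi^T) 0 0,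
        \tr (A x t) <= M & enorm (b x t) <= m]) ->
  cont_on (closure U `*` `[a, e]) w -> C21 U `]T0, +oo[ w ->
  (forall x t, U x -> a < t <= e -> Ltilde A b w x t <= F t) ->
  I a = 0 -> (forall t, a <= t <= e -> is_derive t (1 : R) I (F t)) ->
  (forall t, a <= t <= e -> 0 <= F t) ->
  0 <= J -> 0 <= G ->
  (forall x, closure U x -> w x a <= J) ->
  (forall x t, boundary U x -> a <= t <= e -> w x t <= G) ->
  (forall x t, closure U x -> a <= t <= e -> w x t <= J + (G + I e)) /\
  (forall x, closure U x -> w x e <= (1 - (r / Rk) `^ (2 * be)) * J + (G + I e)).
Proof.
move=> oU bU T0a ae c0 be0 Mbe tauE r0 Ury [x0 Ux0] Abnd cw w21 Lw Ia dI F0 J0 G0 wJ wG.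
have UR x : U x -> enorm (x - y) <= Rk.
  by move=> Ux; case/andP: (Ury x (subset_closure Ux)).
have aee : a <= e <= e by rewrite ltW /=.
have Rk0 : 0 < Rk.
  by have /andP[rx xR] := Ury x0 (subset_closure Ux0); exact: lt_le_trans (le_trans rx xR).
(* Since [F] is nonnegative on [a, e], [I] increases from 0 to [I e], so subtracting it never spoils
   a boundary bound. *)
have Imono s t : a <= s -> s <= t -> t <= e -> I s <= I t.
  move=> as_ st te; apply: (@ger0_derive1_le_cc _ I a e) => //.
  - by move=> z; rewrite in_itv /= => /andP[az ze]; case: (dI z) => //; rewrite !ltW.
  - move=> z; rewrite in_itv /= => /andP[az ze]; rewrite derive1E.
    have aze : a <= z <= e by rewrite !ltW.
    by case: (dI z aze) => _ ->; exact: F0.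
  - by apply: derivable_within_continuous => z; rewrite in_itv /= => aze; case: (dI z aze).
  - by rewrite in_itv /= as_ (le_trans st).
  - by rewrite in_itv /= te (le_trans as_).
have I0 t : a <= t <= e -> 0 <= I t.
  by move=> /andP[at_ te]; rewrite -Ia; exact: Imono.
have Ie t : a <= t <= e -> I t <= I e.
  by move=> /andP[at_ te]; exact: Imono.
have cmp de al K C (de0 : 0 < de) (K0 : 0 <= K) :=
  @cylinder_comparison R n U A b w I F y T0 a e c M m Rk al be de K C oU bU T0a c0 de0 K0 Mbe UR Abnd cw w21 Lw dI.
split.
  move=> x t Ux tae.
  (* With weight K = 0 the barrier drops out; the shift 1 and al = 0 are arbitrary. *)
  have H := cmp 1 0 0 (J + G) ltr01 (lexx 0).
  have {}H : w x t - I t + 0 * barrier 0 be c y x (t - a + 1) <= J + G.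
    apply: (H _ _ x t Ux tae) => [z Uz|z s bz sae].
      by rewrite mul0r addr0 Ia subr0 ler_wpDr // wJ.
    rewrite mul0r addr0; have := wG z s bz sae; have := I0 s sae; lra.
  have := Ie t tae; move: H; rewrite mul0r; lra.
move=> x Ux; set Q := _ `^ _.
have Q0 : 0 <= Q by exact: powR_ge0.
have tau0 : 0 < e - a by rewrite subr_gt0.
pose k := r ^+ 2 / (4 * c * be); pose al := be * (1 + ln k).
pose L1 := expR (be * ln 2) * (2 / (be * k)).
have k0 : 0 < k by apply: divr_gt0; [exact: exprn_gt0|rewrite !mulr_gt0].
have L10 : 0 <= L1.
  by rewrite mulr_ge0 ?expR_ge0 // divr_ge0 // mulr_ge0 // ltW.
(* [L * de] collects both errors of the shift: the barrier is not zero at the bottom, and at the top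
   it is evaluated slightly after [e - a]. *)
pose L := J * (L1 + Q * be / (e - a)).
have L0 : 0 <= L.
  by rewrite mulr_ge0 // addr_ge0 // !mulr_ge0 ?invr_ge0 // ltW.
have rho z : closure U z -> r ^+ 2 <= dot (z - y) (z - y) <= Rk ^+ 2.
  move=> /Ury /andP[rz zR]; rewrite -sqr_enorm.
  by rewrite !ler_sqr ?nnegrE ?enorm_ge0 ?rz ?zR // ltW.
have bound de : 0 < de -> w x e <= (1 - Q) * J + (G + I e) + L * de.
  move=> de0.
  (* Weight K = J: on the bottom w <= J and the barrier is at most [L1 * de]; on the sides w <= G
     and the barrier is at most 1. *)
  have H := cmp de al J (J + G + J * (L1 * de)) de0 J0.
  have {}H : w x e - I e + J * barrier al be c y x (e - a + de) <= J + G + J * (L1 * de).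
    apply: (H _ _ x e Ux aee) => [z Uz|z s bz sae].
      rewrite Ia subr0 subrr add0r.
      have /andP[rz _] := rho z Uz.
      have := ler_wpM2l J0 (barrier_small be0 c0 r0 de0 rz).
      rewrite -/k -/al -/L1; have := wJ z Uz; lra.
    have /andP[rz _] := rho z bz.1.
    have sd0 : 0 < s - a + de by rewrite ltr_wpDl // subr_ge0; case/andP: sae.
    have := ler_wpM2l J0 (barrier_le1 be0 c0 r0 sd0 rz).
    have := mulr_ge0 J0 (mulr_ge0 L10 (ltW de0)).
    rewrite -/k -/al; have := wG z s bz sae; have := I0 s sae; lra.
  have /andP[_ xR] := rho x Ux.
  have eade : e - a <= e - a + de by rewrite lerDl ltW.
  have := ler_wpM2l J0 (barrier_lower be0 c0 r0 Rk0 tau0 eade tauE xR).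
  rewrite -/k -/al -/Q addrAC subrr add0r => lo.
  have -> : L * de = J * (L1 * de) + J * Q * (be * (de / (e - a))).
    by rewrite /L; field; rewrite gt_eqF.
  lra.
apply/ler_addgt0Pr => eps eps0.
have L10' : 0 < L + 1 by rewrite ltr_wpDl.
(* This shift makes the total error at most [eps]; the 1 avoids dividing by zero when L = 0. *)
apply: le_trans (bound (eps / (L + 1)) _) _; first exact: divr_gt0.
rewrite lerD2l mulrA ler_pdivrMr // mulrC ler_wpM2l ?ltW //; lra.
Qed.

(** * Time slices, the lateral boundary and the iteration over all cylinders *)

Lemma le_setmax_slice (R : realType) n (E : set 'rV[R]_n) (S : set R)
    (w : 'rV[R]_n -> R -> R) (x : 'rV[R]_n) (t : R) :
  cont_on (E `*` S) w -> compact E -> E x -> S t ->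
  pospart w x t <= setmax [set pospart w z t | z in E].
Proof.
move=> cw cE Ex St.
have -> : [set pospart w z t | z in E] =
    [set pospart w p.1 p.2 | p in E `*` [set t]].
  apply/seteqP; split=> v /=; first by move=> [z Ez <-]; exists (z, t).
  by move=> [[z s] /= [Ez ->] <-]; exists z.
apply: (le_setmax_pospart (p := (x, t)) cw) => //.
  by move=> [z s] /= [Ez ->].
by apply: compact_setX => //; exact: compact_set1.
Qed.

Lemma compact_boundary (R : realType) n (U : set 'rV[R]_n) :
  bounded_set U -> compact (boundary U).
Proof.
move=> bU; apply: (subclosed_compact _ (compact_closure_bounded bU)) => [|x []//].
rewrite /boundary setDE; apply: closedI; first exact: closed_closure.
exact/open_closedC/open_interior.
Qed.

Unset Implicit Arguments.
Theorem proposition4p5 (R : realType) (n : nat) (hn : (0 < n)%N)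
  (U : set 'rV[R]_n)
  (U_neq0 : U !=set0) (U_open : open U) (U_bounded : bounded_set U)
  (A : 'rV[R]_n -> R -> 'M[R]_n) (b : 'rV[R]_n -> R -> 'rV[R]_n)
  (A_sym : forall x t, U x -> 0 < t -> (A x t)^T = A x t)
  (c0 M1 : R) (c0_gt0 : 0 < c0) (M1_gt0 : 0 < M1)
  (A_elliptic : forall x t, U x -> 0 < t ->
     forall xi : 'rV[R]_n,
       c0 * enorm xi ^+ 2 <= (xi *m A x t *m xi^T) 0 0)
  (A_trace : forall x t, U x -> 0 < t -> \tr (A x t) <= M1)
  (T : nat -> R)
  (T_incr : forall i j : nat, (i < j)%N -> T i < T j)
  (T_ge0 : forall k : nat, 0 <= T k)
  (tau : nat -> R)
  (tauE : forall k : nat, (0 < k)%N -> tau k = T k - T k.-1)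
  (m : nat -> R)
  (b_bound : forall k : nat, (0 < k)%N -> forall x t, U x ->
     T k.-1 < t <= T k -> enorm (b x t) <= m k)
  (y : nat -> 'rV[R]_n)
  (y_out : forall k : nat, (0 < k)%N -> ~ closure U (y k))
  (r Rk beta eta : nat -> R)
  (rE : forall k : nat, (0 < k)%N -> r k = rstar U (y k))
  (RkE : forall k : nat, (0 < k)%N -> Rk k = Rstar U (y k))
  (betaE : forall k : nat, (0 < k)%N ->
     beta k = (M1 + m k * Rk k) / (2 * c0))
  (etaE : forall k : nat, (0 < k)%N ->
     eta k = 1 - (r k / Rk k) `^ (2 * beta k))
  (tau_cond : forall k : nat, (0 < k)%N ->
     4 * c0 * beta k * tau k = Rk k ^+ 2)
  (w : 'rV[R]_n -> R -> R)
  (w_cont : cont_on (closure U `*` `[T 0%N, +oo[) w)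
  (w_C21 : C21 U `]T 0%N, +oo[ w)
  (J : nat -> R)
  (JE : forall k : nat,
     J k = setmax [set pospart w x (T k) | x in closure U])
  (F : R -> R)
  (F_cont : {within `[T 0%N, +oo[, continuous F})
  (F_ge0 : forall t, T 0%N <= t -> 0 <= F t)
  (w_sub : forall x t, U x -> T 0%N < t -> Ltilde A b w x t <= F t)
  (Lambda : nat -> R)
  (Lambda0 : Lambda 0%N = J 0%N)
  (LambdaE : forall k : nat, (0 < k)%N ->
     Lambda k =
       setmax [set pospart w p.1 p.2 | p in boundary U `*` `[T k.-1, T k]]
       + Rintegral lebesgue_measure `[T k.-1, T k] F) :
  forall k : nat, (0 < k)%N ->
    setmax [set pospart w p.1 p.2 | p in closure U `*` `[T k.-1, T k]]
      <= J k.-1 + Lambda k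
    /\
    J k <= \sum_(0 <= i < k.+1) (\prod_(i.+1 <= j < k.+1) eta j) * Lambda i.

Proof.
have ccU : compact (closure U) by exact: compact_closure_bounded.
have [x0 Ux0] := U_neq0.
have cUx0 : closure U x0 := subset_closure Ux0.
have T0T j : T 0%N <= T j by case: j => // j; apply/ltW/T_incr.
have TT j : T j < T j.+1 by exact: T_incr.
have J_ge0 j : 0 <= J j.
  by rewrite JE; apply: setmax_ge0 => _ [z _ <-]; rewrite /pospart le_max lexx.
have wJ j x : closure U x -> w x (T j) <= J j.
  move=> Ux; rewrite JE; have Tj : `[T 0%N, +oo[%classic (T j) by rewrite /= in_itv /= T0T.
  by apply: le_trans (le_setmax_slice w_cont ccU Ux Tj); rewrite /pospart le_max lexx orbT.
(* One cylinder with k = j + 1. The sign of eta is recorded because the induction multiplies an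
   inequality by it. *)
have step j : [/\ 0 <= eta j.+1,
    setmax [set pospart w p.1 p.2 | p in closure U `*` `[T j, T j.+1]]
      <= J j + Lambda j.+1 &
    J j.+1 <= eta j.+1 * J j + Lambda j.+1].
  have k0 : (0 < j.+1)%N by [].
  have y_neq x : closure U x -> x != y j.+1.
    by move=> Ux; apply/eqP => E; apply: (y_out j.+1 k0); rewrite -E.
  have cen : {within closure U, continuous (fun x => enorm (x - y j.+1))}.
    exact/continuous_subspaceT/enormB_continuous.
  have [[z Uz rz] r_le] := compact_setmin ccU cen cUx0.
  rewrite -/(rstar U (y j.+1)) -rE // in rz r_le.
  (* The minimal distance is attained in the closure of [U], which does not contain the point
     y_k. *)
  have r0 : 0 < r j.+1.
    rewrite -rz lt_neqAle enorm_ge0 andbT eq_sym -sqrf_eq0 sqr_enorm dot_eq0.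
    by rewrite subr_eq0 y_neq.
  have Ury x : closure U x -> r j.+1 <= enorm (x - y j.+1) <= Rk j.+1.
    move=> Ux; rewrite r_le //= RkE // /Rstar.
    exact: (compact_le_setmax ccU cen Ux).
  have Rk0 : 0 < Rk j.+1.
    by have /andP[rx xR] := Ury x0 cUx0; exact: lt_le_trans (le_trans rx xR).
  (* [m j.+1] dominates the norm of [b] at (x0, T_{j+1}), a point of the cylinder because its top is
     included; positivity of beta follows. *)
  have m0 : 0 <= m j.+1.
    apply: le_trans (enorm_ge0 (b x0 (T j.+1))) _.
    by apply: b_bound => //=; rewrite TT lexx.
  have be0 : 0 < beta j.+1.
    by rewrite betaE // divr_gt0 ?mulr_gt0 // ltr_pwDl // mulr_ge0 // ltW.
  have Mbe : M1 + m j.+1 * Rk j.+1 = 2 * c0 * beta j.+1.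
    by rewrite betaE // [RHS]mulrC divfK // gt_eqF // mulr_gt0.
  have tauE' : 4 * c0 * beta j.+1 * (T j.+1 - T j) = Rk j.+1 ^+ 2.
    by rewrite -tau_cond // tauE.
  have [I [Ia Ie dI]] := exists_primitive (T0T j) (ltW (TT j)) F_cont.
  set G := setmax [set pospart w p.1 p.2 | p in boundary U `*` `[T j, T j.+1]].
  have LE : Lambda j.+1 = G + I (T j.+1) by rewrite LambdaE // Ie.
  have F0 t : T j <= t <= T j.+1 -> 0 <= F t.
    by move=> /andP[jt _]; apply: F_ge0; exact: le_trans jt.
  have IT0 : 0 <= I (T j.+1).
    by rewrite Ie; apply: Rintegral_ge0 => t; rewrite /= in_itv /=; exact: F0.
  have G0 : 0 <= G.
    by apply: setmax_ge0 => _ [q _ <-]; rewrite /pospart le_max lexx.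
  have L0 : 0 <= Lambda j.+1 by rewrite LE addr_ge0.
  have sub_cyl : closure U `*` `[T j, T j.+1] `<=` closure U `*` `[T 0%N, +oo[.
    move=> [x t] [/= Ux]; rewrite in_itv /= => /andP[jt _]; split => //=.
    by rewrite in_itv /= andbT (le_trans (T0T j)).
  have wG x t : boundary U x -> T j <= t <= T j.+1 -> w x t <= G.
    move=> bx tj; have tI : `[T j, T j.+1]%classic t by rewrite /= in_itv.
    have sub_b : boundary U `*` `[T j, T j.+1] `<=` closure U `*` `[T 0%N, +oo[.
      by move=> [x' t'] [/= [Ux' _] t'I]; apply: (sub_cyl (x', t')); split.
    have cb : compact (boundary U `*` `[T j, T j.+1]).
      by apply: compact_setX; [exact: compact_boundary|exact: segment_compact].
    apply: le_trans (le_setmax_pospart (p := (x, t)) w_cont sub_b cb (conj bx tI)).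
    by rewrite /pospart le_max lexx orbT.
  have Tpos t : T j < t -> 0 < t by apply: le_lt_trans.
  have Abnd x t : U x -> T j < t <= T j.+1 ->
    [/\ (A x t)^T = A x t,
        forall xi : 'rV[R]_n, c0 * enorm xi ^+ 2 <= (xi *m A x t *m xi^T) 0 0,
        \tr (A x t) <= M1 & enorm (b x t) <= m j.+1].
    move=> Ux /[dup] tj /andP[/Tpos t0 _].
    by split; [exact: A_sym|exact: A_elliptic|exact: A_trace|exact: (b_bound j.+1)].
  have Lw x t : U x -> T j < t <= T j.+1 -> Ltilde A b w x t <= F t.
    by move=> Ux /andP[jt _]; apply: w_sub => //; exact: le_lt_trans jt.
  have [P1 P2] := cylinder_step U_open U_bounded (T0T j) (TT j) c0_gt0 be0 Mbe tauE'
    r0 Ury U_neq0 Abnd (continuous_subspaceW sub_cyl w_cont) w_C21 Lw Ia dI F0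
    (J_ge0 j) G0 (wJ j) wG.
  (* Here r <= R, so the power of r/R with positive exponent is at most 1. *)
  have eta0 : 0 <= eta j.+1.
    rewrite etaE // subr_ge0 -[leRHS](congr1 (fun f => f (2 * beta j.+1)) (powR1 R)).
    apply: ge0_ler_powR; rewrite ?nnegrE ?ler01 //.
    - by rewrite mulr_ge0 // ltW.
    - by rewrite divr_ge0 // ltW.
    - by rewrite ler_pdivrMr // mul1r; have /andP[rx xR] := Ury x0 cUx0; exact: le_trans xR.
  split=> //.
    apply: setmax_le => [|_ [[x t] [/= Ux + ] <-]]; first by rewrite addr_ge0.
    rewrite in_itv /= => tj; rewrite /pospart ge_max addr_ge0 //= LE.
    exact: P1.
  rewrite [J j.+1]JE; apply: setmax_le => [|_ [x Ux <-]].
    by rewrite addr_ge0 // mulr_ge0.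
  rewrite /pospart ge_max addr_ge0 ?mulr_ge0 //= etaE // LE.
  exact: P2.
have Jk k : J k <= \sum_(0 <= i < k.+1) (\prod_(i.+1 <= j < k.+1) eta j) * Lambda i.
  elim: k => [|k IH]; first by rewrite big_nat1 big_geq // mul1r Lambda0.
  have [eta0 _ Js] := step k.
  (* The new summand i = k + 1 carries an empty product and is just Lambda; every older product
     gains the factor eta_{k+1}. *)
  rewrite big_nat_recr //= [X in _ + X * _]big_geq // mul1r.
  apply: le_trans Js _; rewrite lerD2r; apply: le_trans (ler_wpM2l eta0 IH) _.
  rewrite mulr_sumr le_eqVlt; apply/orP; left; apply/eqP.
  apply: eq_big_nat => i /andP[_ ik]; rewrite [in RHS]big_nat_recr //=.
  by rewrite mulrA [eta _ * _]mulrC.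
by move=> [//|k] _; split; [have [_] := step k|exact: Jk].
Qed.
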